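(* Let $a\in\mathbb{Z}^n$ with $a_i>0$ for all $i$ and $\gcd(a_1,\dots,a_n)=1$. Suppose $a=M_1p^1+M_2p^2$ with $M_1,M_2\in\mathbb{Z}_{>0}$ and $p^1,p^2\in\mathbb{Z}^n$, and suppose that the $2\times n$ matrix $P$ with rows $p^1,p^2$ has Hermite Normal Form $(I,0)$. Let $q_1,q_2\in\mathbb{Z}$ satisfy $M_1q_1+M_2q_2=1$. Let $k$ be an index $i$ maximizing $p^1_i/a_i$ and $j$ an index $i$ minimizing $p^1_i/a_i$ over $1\le i\le n$. Let $\bar z$ and $\underline z$ be, respectively, the maximum and the minimum of $\mu$ over $$\bar V_+=\{(x,\mu)\in\mathbb{R}^n_+\times\mathbb{R}\mid p^1x-M_2\mu=q_1,\ p^2x+M_1\mu=q_2\}.$$ (a) If $-M_2/2\le q_1\le 0$ and (1a) $\frac{p^1_j}{a_j}>q_1$, (2a) $\frac{p^1_k}{a_k}<M_2+q_1$, (3a) $\left(\frac{1-\bar z}{\bar z-\underline z}\right)\underline z\notin\mathbb{Z}$, then $$F(a)\ge\frac{a_ja_k(M_2+q_1)-p^1_ka_j}{p^1_ka_j-p^1_ja_k}-\frac{M_2}{\frac{p^1_j}{a_j}-q_1}.$$ (b) If $0<q_1\le M_2/2$ and (1b) $\frac{p^1_j}{a_j}>-M_2+q_1$, (2b) $\frac{p^1_k}{a_k}<q_1$, (3b) $\left(\frac{1+\underline z}{\bar z-\underline z}\right)\bar z\notin\mathbb{Z}$, then $$F(a)\ge\frac{a_ja_k(M_2-q_1)+p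^1_ja_k}{p^1_ka_j-p^1_ja_k}+\frac{M_2}{\frac{p^1_k}{a_k}-q_1}.$$
   Context: The Frobenius number $F(a)$ of $a$ is the largest integer $b$ such that $ax=\sum_i a_ix_i=b$ has no solution $x\in\mathbb{Z}^n$ with $x\ge 0$. $\mathbb{R}^n_+$ is the nonnegative orthant, and the products $p^ix$ denote inner products. The Hermite Normal Form of $P$ being $(I,0)$ means that there is an $n\times n$ unimodular integer matrix $U$ with $PU=(I,0)$. *)

(* Defs.v *)
From mathcomp Require Import all_boot all_order all_algebra.
From mathcomp Require Import zify ring lra.
From mathcomp Require Import boolp classical_sets reals.

Set Implicit Arguments.
Unset Strict Implicit.
Unset Printing Implicit Defensive.

Import Order.TTheory GRing.Theory Num.Theory.
Local Open Scope classical_set_scope.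
Local Open Scope ring_scope.

Definition is_max d (T : porderType d) (A : set T) (m : T) : Prop :=
  A m /\ ubound A m.

Definition is_min d (T : porderType d) (A : set T) (m : T) : Prop :=
  A m /\ lbound A m.

Definition dot (K : pzRingType) (n : nat) (u v : 'rV[K]_n) : K :=
  \sum_(i < n) u 0 i * v 0 i.

Definition gcd_entries (n : nat) (a : 'rV[int]_n) : int :=
  \big[gcdz/0]_(i < n) a 0 i.

Definition representable (n : nat) (a : 'rV[int]_n) (b : int) : Prop :=
  exists x : 'rV[int]_n, (forall i, 0 <= x 0 i) /\ dot a x = b.

(* The set ranges over all integers, so the value is -1 when every b >= 0 is
   representable.  The default 0 is never used when a > 0 and gcd = 1, see
   [frobenius_is_max]. *)
Definition frobenius (n : nat) (a : 'rV[int]_n) : int :=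
  xget 0 [set F | is_max [set b | ~ representable a b] F].

(* The Hermite normal form of P is (I, 0).  The condition m <= n is needed for
   (I, 0) to make sense: [pid_mx m] is the block matrix (I, 0) only then. *)
Definition hnf_is_id0 (m n : nat) (P : 'M[int]_(m, n)) : Prop :=
  (m <= n)%N /\
  exists U : 'M[int]_n, U \in unitmx /\ P *m U = pid_mx m.

Definition Vplus (R : realType) (n : nat) (p1 p2 : 'rV[int]_n)
    (M1 M2 q1 q2 : int) : set ('rV[R]_n * R) :=
  [set v : 'rV[R]_n * R | [/\ forall i, 0 <= v.1 0 i,
     dot (map_mx intr p1) v.1 - M2%:~R * v.2 = q1%:~R &
     dot (map_mx intr p2) v.1 + M1%:~R * v.2 = q2%:~R]].
Arguments Vplus R {n} p1 p2 M1 M2 q1 q2.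

Definition quot (R : realType) (n : nat) (u a : 'rV[int]_n) (i : 'I_n) : R :=
  (u 0 i)%:~R / (a 0 i)%:~R.

Lemma bezout_entries (n : nat) (a : 'rV[int]_n) :
  exists u : 'rV[int]_n, dot a u = gcd_entries a.
Proof.
rewrite /gcd_entries.
apply: (big_ind (fun g => exists u : 'rV[int]_n, dot a u = g)).
- by exists 0; rewrite /dot big1 // => i _; rewrite mxE mulr0.
- move=> _ _ [u <-] [v <-].
  have [s [t <-]] := Bezoutz (dot a u) (dot a v).
  exists (s *: u + t *: v); rewrite /dot !mulr_sumr -big_split /=.
  by apply: eq_bigr => i _; rewrite !mxE; ring.
- move=> i _; exists (delta_mx 0 i); rewrite /dot (bigD1 i) //= big1.
    by rewrite mxE !eqxx mulr1 addr0.
  by move=> j /negPf ji; rewrite mxE ji andbF mulr0.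
Qed.

Lemma representable_large (n : nat) (a : 'rV[int]_n) :
  (forall i, 0 < a 0 i) -> gcd_entries a = 1 ->
  exists N : int, forall b, N <= b -> representable a b.
Proof.
move=> a0 g1; have [u] := bezout_entries a; rewrite g1 => au1.
pose s := \sum_(i < n) a 0 i; pose t := \sum_(i < n) `|u 0 i|.
have s_gt0 : 0 < s.
  have s_ge0 : 0 <= s by apply: sumr_ge0 => i _; apply: ltW.
  rewrite lt_neqAle s_ge0 andbT eq_sym; apply/eqP => s0.
  have az : forall i, a 0 i = 0.
    move=> i; apply/eqP; move/eqP: s0.
    by rewrite psumr_eq0 => [|j _]; [move/allP/(_ i); apply; rewrite mem_index_enum
                                    | exact: ltW].
  by move: au1; rewrite /dot big1 // => i _; rewrite az mul0r.
exists (s * (s * t)) => b bN.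
pose q := (b %/ s)%Z; pose r := (b %% s)%Z.
have Eb : b = q * s + r by exact: divz_eq.
have r0 : 0 <= r by apply: modz_ge0; rewrite gt_eqF.
have rs : r < s by apply: ltz_pmod.
have qt : s * t <= q by rewrite /q lez_divRL // mulrC.
exists (\row_i (q + r * u 0 i)); split=> [i|].
  rewrite mxE.
  have ut : `|u 0 i| <= t.
    by rewrite /t (bigD1 i) //= lerDl; apply: sumr_ge0.
  have h : `|r * u 0 i| <= s * t.
    by rewrite normrM (ger0_norm r0); apply: ler_pM => //; apply: ltW.
  have := lerNnormlW h; lia.
rewrite [RHS]Eb -[r in RHS]mulr1 -au1 /dot /s !mulr_sumr -big_split /=.
by apply: eq_bigr => i _; rewrite mxE; ring.
Qed.

Lemma frobenius_is_max (n : nat) (a : 'rV[int]_n) :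
  (forall i, 0 < a 0 i) -> gcd_entries a = 1 ->
  is_max [set b | ~ representable a b] (frobenius a).
Proof.
move=> a0 g1; apply: (@xgetPex _ 0 [set F | is_max _ F]).
have [N HN] := representable_large a0 g1.
have neg : ~ representable a (-1).
  move=> [x [x0 ax]]; have : 0 <= dot a x.
    by apply: sumr_ge0 => i _; rewrite mulr_ge0 // ltW.
  by rewrite ax.
pose A k := `[< ~ representable a (k%:Z - 1) >].
have A0 : exists k, A k by exists 0%N; apply/asboolP.
have Aub k : A k -> (k <= `|N|.+1)%N.
  move=> /asboolP Ak; rewrite leqNgt; apply/negP => lk; apply: Ak; apply: HN; lia.
case: (ex_maxnP A0 Aub) => k /asboolP Ak kmax.
exists (k%:Z - 1); split=> // b /= nb.
have [b0|b0] := leP 0 b; last lia.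
have /kmax : A `|b|.+1.
  by apply/asboolP; rewrite (_ : _ - 1 = b) //; lia.
lia.
Qed.

(* Main.v *)
Require Import Defs.
From mathcomp Require Import all_boot all_order all_algebra.
From mathcomp Require Import boolp classical_sets reals.
From mathcomp Require Import zify ring lra.

Set Implicit Arguments.
Unset Strict Implicit.
Unset Printing Implicit Defensive.

Import Order.TTheory GRing.Theory Num.Theory.
Local Open Scope classical_set_scope.
Local Open Scope ring_scope.

(** Write [t] for [(1 - zmax) / (zmax - zmin)].  Since [a = M1 p1 + M2 p2], a
    point [(x, mu)] of the polyhedron satisfies [a x = 1], and [mu] is then the
    average, with weights [a_i x_i], of the levels [(p1_i / a_i - q1) / M2].
    Hence [zmax] and [zmin] are the levels of the indices [k] and [j], and the
    bound in (a) is just [t - 1 / zmin] ([vertex_level_max],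
    [vertex_level_min]).

    Homogenizing, if [b = a x] with [x] a nonnegative integer vector, the
    corresponding [mu] lies between [b zmin] and [b zmax]; it is moreover an
    integer, because [M1 q1 + M2 q2 = 1] makes [(q1, q2)] and [(M2, - M1)] a
    basis of the integer plane ([representable_level]).  So [b] is not
    representable if no integer lies between [b zmin] and [b zmax].  When
    [0 < zmin], as in (a), this happens if [m / zmin < b < (m + 1) / zmax] for
    some integer [m].  The open interval from [m / zmin] to [(m + 1) / zmax]
    has length greater than 1 exactly when [m < t zmin], and it then contains
    an integer [b].  As [t zmin] is not an integer, [m = floor (t zmin)]
    satisfies this strict inequality, and
    [b > m / zmin > t - 1 / zmin] ([exists_gap]).

    Part (b) is the same argument after the reflection [mu |-> - mu], which
    exchanges [(zmin, zmax)] with [(- zmax, - zmin)]. *)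

Lemma dot_map_intr (R : pzRingType) (n : nat) (u v : 'rV[int]_n) :
  dot (map_mx intr u) (map_mx intr v) = (dot u v)%:~R :> R.
Proof.
by rewrite /dot rmorph_sum; apply: eq_bigr => i _; rewrite !mxE rmorphM.
Qed.

(** The value of [mu] at the vertex of the polyhedron supported on index [i]. *)
Definition vertex_level (R : realType) (n : nat) (p1 a : 'rV[int]_n)
    (M2 q1 : int) (i : 'I_n) : R :=
  (quot R p1 a i - q1%:~R) / M2%:~R.

Lemma ler_vertex_level (R : realType) (n : nat) (p1 a : 'rV[int]_n)
    (M2 q1 : int) (i l : 'I_n) : 0 < M2 ->
  quot R p1 a i <= quot R p1 a l ->
  vertex_level R p1 a M2 q1 i <= vertex_level R p1 a M2 q1 l.
Proof.
by move=> M2_gt0 le_il; rewrite ler_pM2r ?lerD2r // invr_gt0 ltr0z.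
Qed.

(** The equation on [mu] says that it is the sum of the vertex levels with the
    nonnegative weights [a_i x_i]. *)
Lemma level_bounds (R : realType) (n : nat) (p1 a : 'rV[int]_n) (M2 q1 : int)
    (lo hi : R) (x : 'rV[R]_n) (mu : R) :
  (forall i, 0 < a 0 i) -> 0 < M2 ->
  (forall i, lo <= vertex_level R p1 a M2 q1 i <= hi) ->
  (forall i, 0 <= x 0 i) ->
  dot (map_mx intr p1) x - M2%:~R * mu
    = q1%:~R * dot (map_mx intr a) x ->
  lo * dot (map_mx intr a) x <= mu <= hi * dot (map_mx intr a) x.
Proof.
move=> a_gt0 M2_gt0 lvl x_ge0 Emu.
have M2_neq0 : M2%:~R != 0 :> R by rewrite intr_eq0 gt_eqF.
have -> : mu = \sum_i vertex_level R p1 a M2 q1 i * ((a 0 i)%:~R * x 0 i).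
  have -> : mu = (dot (map_mx intr p1) x - q1%:~R * dot (map_mx intr a) x)
                   / M2%:~R by rewrite -Emu; field.
  rewrite /dot mulr_sumr -sumrB mulr_suml; apply: eq_bigr => i _.
  rewrite !mxE /vertex_level /quot; field.
  by rewrite M2_neq0 intr_eq0 gt_eqF.
have w_ge0 i : 0 <= (a 0 i)%:~R * x 0 i by rewrite mulr_ge0 // ler0z ltW.
by rewrite /dot !mulr_sumr; apply/andP; split; apply: ler_sum => i _;
   rewrite mxE ler_wpM2r //; case/andP: (lvl i).
Qed.

Lemma vertex_in_Vplus (R : realType) (n : nat) (a p1 p2 : 'rV[int]_n)
    (M1 M2 q1 q2 : int) (i : 'I_n) :
  0 < a 0 i -> 0 < M2 ->
  a = M1 *: p1 + M2 *: p2 -> M1 * q1 + M2 * q2 = 1 ->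
  (snd @` Vplus R p1 p2 M1 M2 q1 q2) (vertex_level R p1 a M2 q1 i).
Proof.
move=> ai_gt0 M2_gt0 a_def q_def.
have M2_neq0 : M2%:~R != 0 :> R by rewrite intr_eq0 gt_eqF.
have ai_neq0 : (a 0 i)%:~R != 0 :> R by rewrite intr_eq0 gt_eqF.
exists ((a 0 i)%:~R^-1 *: delta_mx 0 i, vertex_level R p1 a M2 q1 i) => //.
have dot_vertex (p : 'rV[int]_n) :
    dot (map_mx intr p) ((a 0 i)%:~R^-1 *: delta_mx 0 i) = quot R p a i.
  rewrite /dot (bigD1 i) //= big1 => [|l /negPf l_neq_i].
    by rewrite !mxE !eqxx mulr1 addr0.
  by rewrite !mxE l_neq_i andbF !mulr0.
split=> /= [l||].
- by rewrite !mxE mulr_ge0 ?invr_ge0 ?ler0z ?(ltW ai_gt0) // ler0n.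
- by rewrite dot_vertex /vertex_level; field.
- rewrite dot_vertex /vertex_level /quot.
  have -> : (p2 0 i)%:~R = ((a 0 i)%:~R - M1%:~R * (p1 0 i)%:~R) / M2%:~R :> R.
    by rewrite a_def !mxE rmorphD !rmorphM /=; field.
  have -> : q2%:~R = (1 - M1%:~R * q1%:~R) / M2%:~R :> R.
    have Eq : M1%:~R * q1%:~R + M2%:~R * q2%:~R = 1 :> R.
      by rewrite -!rmorphM -rmorphD q_def.
    by apply: (canRL (mulfK M2_neq0)); lra.
  by field; rewrite M2_neq0.
Qed.

Lemma Vplus_level_bounds (R : realType) (n : nat) (a p1 p2 : 'rV[int]_n)
    (M1 M2 q1 q2 : int) (lo hi z : R) :
  (forall i, 0 < a 0 i) -> 0 < M2 ->
  a = M1 *: p1 + M2 *: p2 -> M1 * q1 + M2 * q2 = 1 ->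
  (forall i, lo <= vertex_level R p1 a M2 q1 i <= hi) ->
  (snd @` Vplus R p1 p2 M1 M2 q1 q2) z -> lo <= z <= hi.
Proof.
move=> a_gt0 M2_gt0 a_def q_def lvl [[x mu] /= [x_ge0 E1 E2] <-].
have ax1 : dot (map_mx intr a) x = 1.
  have -> : dot (map_mx intr a) x = M1%:~R * dot (map_mx intr p1) x
                                    + M2%:~R * dot (map_mx intr p2) x.
    rewrite /dot !mulr_sumr -big_split; apply: eq_bigr => i _ /=.
    by rewrite a_def !mxE rmorphD !rmorphM; ring.
  have : M1%:~R * q1%:~R + M2%:~R * q2%:~R = 1 :> R.
    by rewrite -!rmorphM -rmorphD q_def.
  by rewrite -E1 -E2; lra.
have := level_bounds a_gt0 M2_gt0 lvl x_ge0.
by rewrite ax1 !mulr1; apply.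
Qed.

Lemma vertex_level_max (R : realType) (n : nat) (a p1 p2 : 'rV[int]_n)
    (M1 M2 q1 q2 : int) (k j : 'I_n) (z : R) :
  (forall i, 0 < a 0 i) -> 0 < M2 ->
  a = M1 *: p1 + M2 *: p2 -> M1 * q1 + M2 * q2 = 1 ->
  (forall i, quot R p1 a j <= quot R p1 a i <= quot R p1 a k) ->
  is_max (snd @` Vplus R p1 p2 M1 M2 q1 q2) z ->
  z = vertex_level R p1 a M2 q1 k.
Proof.
move=> a_gt0 M2_gt0 a_def q_def jk [Vz ubz].
apply/le_anti/andP; split; last first.
  by apply: ubz; apply: vertex_in_Vplus.
have lvl i : vertex_level R p1 a M2 q1 j <= vertex_level R p1 a M2 q1 i
             <= vertex_level R p1 a M2 q1 k.
  by have /andP[ji ik] := jk i; rewrite !ler_vertex_level.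
by have /andP[] := Vplus_level_bounds a_gt0 M2_gt0 a_def q_def lvl Vz.
Qed.

Lemma vertex_level_min (R : realType) (n : nat) (a p1 p2 : 'rV[int]_n)
    (M1 M2 q1 q2 : int) (k j : 'I_n) (z : R) :
  (forall i, 0 < a 0 i) -> 0 < M2 ->
  a = M1 *: p1 + M2 *: p2 -> M1 * q1 + M2 * q2 = 1 ->
  (forall i, quot R p1 a j <= quot R p1 a i <= quot R p1 a k) ->
  is_min (snd @` Vplus R p1 p2 M1 M2 q1 q2) z ->
  z = vertex_level R p1 a M2 q1 j.
Proof.
move=> a_gt0 M2_gt0 a_def q_def jk [Vz lbz].
apply/le_anti/andP; split.
  by apply: lbz; apply: vertex_in_Vplus.
have lvl i : vertex_level R p1 a M2 q1 j <= vertex_level R p1 a M2 q1 i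
             <= vertex_level R p1 a M2 q1 k.
  by have /andP[ji ik] := jk i; rewrite !ler_vertex_level.
by have /andP[] := Vplus_level_bounds a_gt0 M2_gt0 a_def q_def lvl Vz.
Qed.

(** For an integer [x], the value [mu = q2 (p1 x) - q1 (p2 x)] solves both
    homogenized equations, so the level of [x] is an integer. *)
Lemma representable_level (R : realType) (n : nat) (a p1 p2 : 'rV[int]_n)
    (M1 M2 q1 q2 : int) (lo hi : R) (b : int) :
  (forall i, 0 < a 0 i) -> 0 < M2 ->
  a = M1 *: p1 + M2 *: p2 -> M1 * q1 + M2 * q2 = 1 ->
  (forall i, lo <= vertex_level R p1 a M2 q1 i <= hi) ->
  representable a b ->
  exists mu : int, lo * b%:~R <= mu%:~R <= hi * b%:~R.
Proof.
move=> a_gt0 M2_gt0 a_def q_def lvl [x [x_ge0 ax]].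
exists (q2 * dot p1 x - q1 * dot p2 x).
have ax' : b = M1 * dot p1 x + M2 * dot p2 x.
  rewrite -ax /dot !mulr_sumr -big_split; apply: eq_bigr => i _ /=.
  by rewrite a_def !mxE; ring.
rewrite -ax -dot_map_intr; apply: (level_bounds a_gt0 M2_gt0 lvl) => [i|].
  by rewrite mxE ler0z.
rewrite !dot_map_intr -!rmorphM -rmorphB ax; congr intr.
rewrite ax' -[X in X - _]mul1r -q_def; ring.
Qed.

(** With [t = (1 - v) / (v - u)], the open interval from [m / u] to
    [(m + 1) / v] has length greater than 1 exactly when [m < t * u]; the
    largest such [m] gives the best lower bound on an integer [b] in it. *)
Lemma exists_gap (R : realType) (u v : R) :
  0 < u -> u <= v ->
  (1 - v) / (v - u) * u \isn't a Num.int ->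
  exists b m : int, [/\ (1 - v) / (v - u) - u^-1 <= b%:~R,
                        m%:~R < u * b%:~R & v * b%:~R < (m + 1)%:~R].
Proof.
move=> u_gt0 uv; set t := (1 - v) / (v - u) => tuN.
have v_gt0 : 0 < v by apply: lt_le_trans uv.
(* If v = u, the convention 1 / 0 = 0 makes t * u = 0 an integer. *)
have d_gt0 : 0 < v - u.
  rewrite lt_neqAle subr_ge0 uv andbT eq_sym; apply: contraNneq tuN => d0.
  by rewrite /t d0 invr0 mulr0 mul0r int_num0.
have Et : t * (v - u) = 1 - v by rewrite divfK // gt_eqF.
pose m := Num.floor (t * u).
have m_lt : m%:~R < t * u.
  rewrite lt_neqAle floor_le andbT; apply: contraNneq tuN => <-.
  exact: intr_int.
have lt_m : t * u < (m + 1)%:~R by exact: floorD1_gt.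
pose b := Num.floor (m%:~R / u) + 1.
have lt_b : m%:~R / u < b%:~R by exact: floorD1_gt.
have b_le : b%:~R <= m%:~R / u + 1.
  by rewrite rmorphD lerD2r floor_le.
clearbody b.
have ub : m%:~R < u * b%:~R by rewrite mulrC -ltr_pdivrMr.
exists b, m; split => //.
- apply/ltW/(lt_trans _ lt_b); rewrite ltr_pdivlMr // mulrBl mulVf ?gt_eqF //.
  by rewrite ltrBlDr -[1]/(1%:~R) -rmorphD.
- have ub_le : u * b%:~R <= m%:~R + u.
    have -> : m%:~R + u = u * (m%:~R / u + 1) by field; rewrite gt_eqF.
    by rewrite ler_pM2l.
  rewrite -(ltr_pM2l u_gt0) rmorphD /=.
  apply: (@le_lt_trans _ _ (v * (m%:~R + u))).
    by rewrite mulrCA ler_pM2l.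
  (* What remains is m * (v - u) < u * (1 - v), that is, m < t * u. *)
  have : m%:~R * (v - u) < t * u * (v - u) by rewrite ltr_pM2r.
  rewrite mulrAC Et; lra.
Qed.

Lemma frobenius_ge_of_levels (R : realType) (n : nat) (a : 'rV[int]_n)
    (u v : R) :
  (forall i, 0 < a 0 i) -> gcd_entries a = 1 ->
  (forall b, representable a b ->
     exists mu : int, u * b%:~R <= mu%:~R <= v * b%:~R) ->
  0 < u -> u <= v ->
  (1 - v) / (v - u) * u \isn't a Num.int ->
  (1 - v) / (v - u) - u^-1 <= (frobenius a)%:~R.
Proof.
move=> a_gt0 a_gcd lvl u_gt0 uv tuN.
have [b [m [b_ge mb bm]]] := exists_gap u_gt0 uv tuN.
apply: (le_trans b_ge); rewrite ler_int.
have [_] := frobenius_is_max a_gt0 a_gcd; apply => /lvl[mu /andP[lo hi]].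
have := lt_le_trans mb lo; have := le_lt_trans hi bm.
rewrite !ltr_int; lia.
Qed.

Theorem theorem9 (R : realType) (n : nat) (a p1 p2 : 'rV[int]_n)
    (M1 M2 q1 q2 : int) (k j : 'I_n) (zmax zmin : R)
    (a_gt0 : forall i, 0 < a 0 i)
    (a_gcd : gcd_entries a = 1)
    (M1_gt0 : 0 < M1) (M2_gt0 : 0 < M2)
    (a_def : a = M1 *: p1 + M2 *: p2)
    (P_hnf : hnf_is_id0 (col_mx p1 p2))
    (q_def : M1 * q1 + M2 * q2 = 1)
    (k_max : forall i, quot R p1 a i <= quot R p1 a k)
    (j_min : forall i, quot R p1 a j <= quot R p1 a i)
    (zmax_def : is_max (snd @` Vplus R p1 p2 M1 M2 q1 q2) zmax)
    (zmin_def : is_min (snd @` Vplus R p1 p2 M1 M2 q1 q2) zmin) :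
  let aj : R := (a 0 j)%:~R in
  let ak : R := (a 0 k)%:~R in
  let pj : R := (p1 0 j)%:~R in
  let pk : R := (p1 0 k)%:~R in
  let m2 : R := M2%:~R in
  let r1 : R := q1%:~R in
  let F : R := (frobenius a)%:~R in
  (- m2 / 2 <= r1 <= 0 ->
   pj / aj > r1 ->
   pk / ak < m2 + r1 ->
   (1 - zmax) / (zmax - zmin) * zmin \isn't a Num.int ->
   F >= (aj * ak * (m2 + r1) - pk * aj) / (pk * aj - pj * ak)
        - m2 / (pj / aj - r1))
  /\
  (0 < r1 <= m2 / 2 ->
   pj / aj > - m2 + r1 ->
   pk / ak < r1 ->
   (1 + zmin) / (zmax - zmin) * zmax \isn't a Num.int ->
   F >= (aj * ak * (m2 - r1) + pj * ak) / (pk * aj - pj * ak)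
        + m2 / (pk / ak - r1)).
Proof.
move=> aj ak pj pk m2 r1 F.
have jk i : quot R p1 a j <= quot R p1 a i <= quot R p1 a k.
  by rewrite j_min k_max.
have Ezmax := vertex_level_max a_gt0 M2_gt0 a_def q_def jk zmax_def.
have Ezmin := vertex_level_min a_gt0 M2_gt0 a_def q_def jk zmin_def.
have lvl b : representable a b ->
    exists mu : int, zmin * b%:~R <= mu%:~R <= zmax * b%:~R.
  apply: (representable_level a_gt0 M2_gt0 a_def q_def) => i.
  by rewrite Ezmin Ezmax !ler_vertex_level.
have zz : zmin <= zmax by rewrite Ezmin Ezmax ler_vertex_level.
have m2_gt0 : 0 < m2 by rewrite ltr0z.
have aj_gt0 : 0 < aj by rewrite ltr0z.
have ak_gt0 : 0 < ak by rewrite ltr0z.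
have {}Ezmax : zmax = (pk / ak - r1) / m2 by [].
have {}Ezmin : zmin = (pj / aj - r1) / m2 by [].
have m2_neq0 : m2 != 0 by rewrite gt_eqF.
have aj_neq0 : aj != 0 by rewrite gt_eqF.
have ak_neq0 : ak != 0 by rewrite gt_eqF.
have Ed : pk * aj - pj * ak = (zmax - zmin) * (m2 * aj * ak).
  by rewrite Ezmax Ezmin; field; rewrite m2_neq0 aj_neq0.
have c_neq0 : m2 * aj * ak != 0 by rewrite !mulf_neq0.
split=> _ lo hi tN.
- have -> : aj * ak * (m2 + r1) - pk * aj = (1 - zmax) * (m2 * aj * ak).
    by rewrite Ezmax; field; rewrite m2_neq0.
  rewrite Ed -mulf_div divff // mulr1 -[m2 / _]invf_div -Ezmin.
  apply: frobenius_ge_of_levels => //.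
  by rewrite Ezmin divr_gt0 // subr_gt0.
- have -> : aj * ak * (m2 - r1) + pj * ak = (1 + zmin) * (m2 * aj * ak).
    by rewrite Ezmin; field; rewrite m2_neq0.
  rewrite Ed -mulf_div divff // mulr1 -[m2 / _]invf_div -Ezmax.
  have -> : (1 + zmin) / (zmax - zmin) + zmax^-1
      = (1 - - zmin) / (- zmin - - zmax) - (- zmax)^-1.
    by rewrite invrN !opprK [- zmin + _]addrC.
  apply: frobenius_ge_of_levels => //.
  + move=> b /lvl[mu /andP[lo_mu mu_hi]]; exists (- mu).
    by rewrite rmorphN !mulNr !lerN2 lo_mu mu_hi.
  + by rewrite oppr_gt0 Ezmax pmulr_llt0 ?invr_gt0 // subr_lt0.
  + by rewrite lerN2.
  + by rewrite !opprK [- zmin + _]addrC mulrN rpredN.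
Qed.
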